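(* Let $\tau$ be an operational type. The Boolean-topological algebras of type $\tau$ are precisely the extended Stone dual spaces of Boolean residuation algebras of type $\tau$ for which the dual relations are functional. That is, let $X$ be a Boolean space equipped, for each $n$-ary $f\in\tau$, with a relation $R_f\subseteq X^n\times X$. Then the following are equivalent: (a) for each $f\in\tau$ the relation $R_f$ is the graph of a continuous operation $X^n\to X$ (so that $X$ with these operations is a Boolean-topological algebra); (b) $(X,(R_f)_{f\in\tau})$ is isomorphic to the extended Stone dual of some Boolean residuation algebra of type $\tau$, and each $R_f$ is functional, i.e. is the graph of an $n$-ary operation on $X$.
   Context: All operation symbols of $\tau$ have finite arity $n\geq 1$. A Boolean space is a compact Hausdorff space with a basis of clopen sets. A Boolean-topological algebra is a Boolean space equipped with an algebra structure whose basic operations are continuous. A Boolean residuation algebra of type $\tau$ is a Boolean algebra $B$ with, for each $n$-ary $f\in\tau$ and each $1\leq i\leq n$, an operation $f_i^{\sharp}:B^n\to B$, written $f_i^{\sharp}(a_1,\ldots,a_{i-1},a_{i+1},\ldots,a_n,c)$, which preserves finite meets (including the empty one) in its last coordinate $c$, and such that for all $i,j$ and all $a_1,\ldots,a_n,c\in B$: $a_i\leq f_i^{\sharp}(a_1,\ldots,a_{i-1},a_{i+1},\ldots,a_n,c)\iff a_j\leq f_j^{\sharp}(a_1,\ldots,a_{j-1},a_{j+1},\ldots,a_n,c)$. The extended Stone dual of $B$ is the Stone space $X_B$ (points $x$ are prime filters $F_x$ of $B$, topology generated by the sets $\{x\mid a\in F_x\}$, $a\in B$) equipped with, for each $n$-ary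 $f$, the relation $R_f\subseteq X_B^{n}\times X_B$ where $(x_1,\ldots,x_n,z)\in R_f$ if and only if for all $a_j\in F_{x_j}$ ($j\neq i$) and all $c\notin F_z$ we have $f_i^\sharp(a_1,\ldots,a_{i-1},a_{i+1},\ldots,a_n,c)\notin F_{x_i}$; this condition does not depend on the choice of $i$. Isomorphisms of such structures are homeomorphisms preserving and reflecting all the relations. *)

(* Defs.v *)
From HB Require Import structures.
From mathcomp Require Import all_boot all_order all_classical.
From mathcomp Require Export topology.

Set Implicit Arguments.
Unset Strict Implicit.
Unset Printing Implicit Defensive.

Import Order.TTheory.
Local Open Scope classical_set_scope.
Local Open Scope order_scope.

Record signature := Signature {
  symbol :> Type;
  arity : symbol -> nat;
  arity_gt0 : forall f : symbol, (0 < arity f)%N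
}.

(* The tuple (a_1, .., a_{i-1}, a_{i+1}, .., a_n) obtained by deleting the
   i-th entry, reindexed by 'I_n.-1. *)
Definition drop_at (n : nat) (T : Type) (i : 'I_n) (a : 'I_n -> T) :
  'I_n.-1 -> T := fun k => a (lift i k).

Definition boolean_space (X : topologicalType) : Prop :=
  [/\ compact [set: X], hausdorff_space X &
      exists2 U : set (set X), U `<=` clopen & basis U].

(* [residual i a c] is f_i^#(a_1, .., a_{i-1}, a_{i+1}, .., a_n, c), the n-1
   arguments other than [c] being listed in order by [a]. *)
Record residuationAlgebra (tau : signature) (d : Order.disp_t) :=
  ResiduationAlgebra {
  carrier :> ctbDistrLatticeType d;
  residual : forall f : tau, 'I_(arity f) ->
    ('I_(arity f).-1 -> carrier) -> carrier -> carrier;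
  residualT : forall (f : tau) (i : 'I_(arity f)) a,
    residual i a \top = \top;
  residualI : forall (f : tau) (i : 'I_(arity f)) a c c',
    residual i a (c `&` c') = residual i a c `&` residual i a c';
  residuation : forall (f : tau) (i j : 'I_(arity f))
      (a : 'I_(arity f) -> carrier) (c : carrier),
    a i <= residual i (drop_at i a) c <-> a j <= residual j (drop_at j a) c
}.

Section StoneSpace.
Context {d : Order.disp_t} (B : ctbDistrLatticeType d).

Record prime_filter (F : set B) : Prop := PrimeFilter {
  prime_filterT : F \top;
  prime_filterS : forall a b, a <= b -> F a -> F b;
  prime_filterI : forall a b, F a -> F b -> F (a `&` b);
  prime_filter0 : ~ F \bot;
  prime_filterU : forall a b, F (a `|` b) -> F a \/ F b
}.

Record stone := Stone {
  filter_of : set B;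
  stoneP : prime_filter filter_of
}.

HB.instance Definition _ := gen_eqMixin stone.
HB.instance Definition _ := gen_choiceMixin stone.

Definition stone_open (a : B) : set stone := [set x | filter_of x a].

(* The subbase is indexed by itself: the factory wants a pointed index type,
   which [B] is not. *)
HB.instance Definition _ :=
  isSubBaseTopological.Build stone (range stone_open) id.

End StoneSpace.

Section DualRelation.
Context {tau : signature} {d : Order.disp_t} (B : residuationAlgebra tau d).

Definition dual_rel_at (f : tau) (i : 'I_(arity f))
    (x : 'I_(arity f) -> stone B) (z : stone B) : Prop :=
  forall (a : 'I_(arity f).-1 -> B) (c : B),
    (forall k, filter_of (drop_at i x k) (a k)) -> ~ filter_of z c ->
    ~ filter_of (x i) (residual i a c).

(* By [dual_relE] below it is the same to require this for a single [i];
   recall that arities are positive. *)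
Definition dual_rel (f : tau) (x : 'I_(arity f) -> stone B) (z : stone B) :
  Prop := forall i, dual_rel_at i x z.

Lemma dual_rel_at_indep (f : tau) (i j : 'I_(arity f))
    (x : 'I_(arity f) -> stone B) (z : stone B) :
  dual_rel_at i x z -> dual_rel_at j x z.
Proof.
have [-> //|neq_ij] := eqVneq i j.
move=> Ri a c xa zc xjr.
pose a' k := if unlift j k is Some l then a l else residual j a c.
have a'j : drop_at j a' = a by apply: funext => k; rewrite /drop_at /a' liftK.
have xa' k : filter_of (x k) (a' k).
  by rewrite /a'; case: unliftP => [l ->|-> //]; exact: xa.
have : a' i <= residual i (drop_at i a') c.
  by apply/(residuation i j); rewrite a'j /a' unlift_none.
move=> /(prime_filterS (stoneP (x i)))/(_ (xa' i)); apply: Ri => // k.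
exact: xa'.
Qed.

Lemma dual_relE (f : tau) (i : 'I_(arity f))
    (x : 'I_(arity f) -> stone B) (z : stone B) :
  dual_rel x z <-> dual_rel_at i x z.
Proof. by split=> [/(_ i)//|Ri j]; exact: dual_rel_at_indep Ri. Qed.

End DualRelation.

Definition relational_iso (tau : signature) (X Y : topologicalType)
    (R : forall f : tau, ('I_(arity f) -> X) -> X -> Prop)
    (S : forall f : tau, ('I_(arity f) -> Y) -> Y -> Prop) : Prop :=
  exists (h : X -> Y) (g : Y -> X),
    [/\ cancel h g, cancel g h, continuous h, continuous g &
        forall (f : tau) x z, R f x z <-> S f (h \o x) (h z)].

Definition is_graph (n : nat) (X : Type) (R : ('I_n -> X) -> X -> Prop)
    (op : ('I_n -> X) -> X) : Prop :=
  forall x z, R x z <-> op x = z.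

(* Main.v *)
Require Import Defs.
From HB Require Import structures.
From mathcomp Require Import all_boot all_order all_classical topology.

(** From operations to residuals.  Given continuous operations on a Boolean
    space X, let B be the Boolean algebra of clopen subsets of X.  For clopen
    a_j and c, the largest set a_i such that op maps a_1 x .. x a_n into c has
    as complement the i-th projection of
      {y | y_j in a_j for all j <> i, and op y not in c}.
    This set is clopen because op is continuous, and its projection is clopen
    because projections are open maps and, X being compact Hausdorff, closed
    maps as well ([clopen_projection]).  So residuals exist inside B
    ([clopen_residual_set]); the residuation law holds because both its sides
    say that op maps a_1 x .. x a_n into c ([residual_setP]).  By Stone duality
    x |-> {U | x in U} is a homeomorphism from X to the dual of B.  It carries
    the graph of op to the dual relation ([dual_rel_clopen_algebra]): if
    op x <> z, some clopen c contains op x but not z, and by continuity op maps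
    a clopen box around x into c, which refutes the dual relation at (x, z).

    From residuals to continuity.  The dual relation of any residuation algebra
    is closed in the product topology, since its failure at (x, z) is witnessed
    by finitely many membership conditions on x and z ([closed_dual_rel]).
    Hence, if it is the graph of an operation, this operation has a closed
    graph with compact Hausdorff codomain, and so is continuous
    ([closed_graph_continuous]). *)

Set Implicit Arguments.
Unset Strict Implicit.
Unset Printing Implicit Defensive.

Import Order.Theory.
Local Open Scope order_scope.
Local Open Scope classical_set_scope.

(** * Products and closed graphs *)

Lemma cvg_coordinatewise (I : Type) (K : I -> topologicalType)
    (F : set_system (prod_topology K)) (t : prod_topology K) :
  Filter F -> (forall i, (fun g => g i) @ F --> t i) -> F --> t.
Proof.
move=> FF Ft; apply/cvg_sup => i A [_ [[B oB <-] Bt] sBA].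
by apply: (filterS sBA); apply: Ft; exact: open_nbhs_nbhs.
Qed.

Lemma continuous_coordinate (I : eqType) (K : I -> topologicalType) (i : I) :
  continuous (fun y : prod_topology K => y i).
Proof. exact: proj_continuous. Qed.

Lemma continuous_postcomp (I : eqType) (X Y : topologicalType) (h : X -> Y) :
  continuous h -> continuous (fun x : {ptws I -> X} => h \o x : {ptws I -> Y}).
Proof.
move=> h_cont x.
apply: (@cvg_coordinatewise _ (fun=> Y) _ _
  (@fmap_filter _ _ _ _ (nbhs_filter x))) => i.
exact: (cvg_comp _ _ (@continuous_coordinate _ (fun=> X) i x) (h_cont (x i))).
Qed.

(** The reindexing [s] serves for boxes that leave some coordinates free: with
    [s := lift i] the [i]-th coordinate is unconstrained. *)
Lemma nbhs_box (J : finType) (I : eqType) (K : I -> topologicalType)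
    (s : J -> I) (a : forall j, set (K (s j))) (x : prod_topology K) :
  (forall j, nbhs (x (s j)) (a j)) ->
  nbhs x [set y : prod_topology K | forall j, a j (y (s j))].
Proof.
move=> xa; change (\forall y \near nbhs x, forall j, a j (y (s j))).
apply: filter_forall => j.
exact: (@continuous_coordinate _ K (s j) x (a j) (xa j)).
Qed.

Lemma clopen_coordinatewise (J : finType) (I : eqType)
    (K : I -> topologicalType)
    (s : J -> I) (a : forall j, set (K (s j))) :
  (forall j, clopen (a j)) ->
  clopen [set y : prod_topology K | forall j, a j (y (s j))].
Proof.
move=> ca; split.
  rewrite openE => y ya; apply: nbhs_box => j.
  by apply: open_nbhs_nbhs; split; [case: (ca j)|exact: ya].
rewrite (_ : [set y | _] =
    \bigcap_j ((fun y : prod_topology K => y (s j)) @^-1` a j)); last first.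
  by apply/seteqP; split=> y ya j => [_|]; exact: ya.
apply: closed_bigI => j _.
by have [] := preimage_clopen (ca j) (@continuous_coordinate _ K (s j)).
Qed.

(** Projections are open maps; onto a Hausdorff factor, a projection from a
    compact product is also closed. *)
Lemma clopen_projection (I : eqType) (K : I -> topologicalType) (i : I)
    (S : set (prod_topology K)) :
  (forall j, compact [set: K j]) -> hausdorff_space (K i) ->
  clopen S -> clopen ((fun y => y i) @` S).
Proof.
move=> cK hausK [oS clS]; split; first exact: proj_open.
apply: compact_closed => //; apply: continuous_compact.
  exact/continuous_subspaceT/continuous_coordinate.
apply: (subclosed_compact clS (tychonoff cK)).
by move=> y _ j.
Qed.

(** By compactness it is enough that [f y] is the only cluster point of [f] at
    [y]; a cluster point [z] makes [(y, z)] adherent to the graph. *)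
Lemma closed_graph_continuous (Y X : topologicalType) (f : Y -> X) :
  compact [set: X] -> hausdorff_space X ->
  closed [set p : Y * X | f p.1 = p.2] -> continuous f.
Proof.
move=> cX hX clf y.
apply: (compact_cluster_set1 hX cX filterT).
  exact: filterT.
apply/seteqP; split=> [z|_ -> U V /= fU fV]; last first.
  by exists (f y); split; [exact: (nbhs_singleton fU)|exact: nbhs_singleton].
move=> clz; apply/esym/(clf (y, z)) => W [[U V] /= [yU zV] sUVW].
have fU : (f @ y) (f @` U) by apply: filterS yU => u Uu; exists u.
have [_ [[u Uu <-] Vfu]] := clz _ _ fU zV.
by exists (u, f u); split=> //; apply: sUVW.
Qed.

(** * The Boolean algebra of clopen sets *)

Section ClopenAlgebra.
Context {X : topologicalType}.

Definition clopen_pred : {pred set X} := fun U => `[< clopen U >].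

Lemma clopen_predP (U : set X) : reflect (clopen U) (U \in clopen_pred).
Proof. exact: asboolP. Qed.

Record clopen_set := ClopenSet {
  clopen_val :> set X;
  clopen_valP : clopen_val \in clopen_pred
}.

HB.instance Definition _ := [isSub for clopen_val].
HB.instance Definition _ := [Choice of clopen_set by <:].

Lemma clopen_meet : meet_closed clopen_pred.
Proof.
by move=> U V /clopen_predP cU /clopen_predP cV; apply/clopen_predP/clopenI.
Qed.

Lemma clopen_join : join_closed clopen_pred.
Proof.
by move=> U V /clopen_predP cU /clopen_predP cV; apply/clopen_predP/clopenU.
Qed.

Lemma clopen_bot : \bot \in clopen_pred.
Proof. exact/clopen_predP/clopen0. Qed.

Lemma clopen_top : \top \in clopen_pred.
Proof. exact/clopen_predP/clopenT. Qed.

HB.instance Definition _ :=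
  Order.SubChoice_isTBSubLattice.Build _ (set X) clopen_pred set_display
    clopen_set clopen_meet clopen_join clopen_bot clopen_top.

Lemma clopen_meetUl : left_distributive (@Order.meet _ clopen_set) Order.join.
Proof. by move=> U V W; apply: val_inj; exact: setIUl. Qed.

HB.instance Definition _ :=
  Order.Lattice_Meet_isDistrLattice.Build _ clopen_set clopen_meetUl.

Lemma clopen_set_clopen (U : clopen_set) : clopen U.
Proof. exact/clopen_predP/clopen_valP. Qed.

Definition clopen_of (U : set X) (cU : clopen U) : clopen_set :=
  ClopenSet (introT (clopen_predP U) cU).

Definition clopen_compl (U : clopen_set) : clopen_set :=
  clopen_of (clopenC setT (clopen_set_clopen U)).

Lemma clopen_joinxC (U : clopen_set) : (U `|` clopen_compl U = \top)%O.
Proof. by apply: val_inj; exact: setUv. Qed.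

Lemma clopen_meetxC (U : clopen_set) : (U `&` clopen_compl U = \bot)%O.
Proof. by apply: val_inj; exact: setICr. Qed.

HB.instance Definition _ :=
  Order.TBDistrLattice_hasComplement.Build _ clopen_set
    clopen_joinxC clopen_meetxC.

Lemma clopen_subset (U V : clopen_set) : (U <= V)%O <-> (U `<=` V)%classic.
Proof. by split=> /subsetPset. Qed.

End ClopenAlgebra.
Arguments clopen_set : clear implicits.

(** * The dual space of a residuation algebra *)

Section StoneTopology.
Context {d : Order.disp_t} {B : ctbDistrLatticeType d}.
Implicit Types (s t : stone B) (a : B).

Lemma stone_eq s t : filter_of s = filter_of t -> s = t.
Proof.
case: s t => [F pF] [G pG] /= FG; subst G; congr Stone.
exact: Prop_irrelevance.
Qed.

Lemma filter_of_compl s a : filter_of s (~` a)%O <-> ~ filter_of s a.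
Proof.
split=> [sCa sa|nsa].
  apply: (prime_filter0 (stoneP s)); rewrite -(meetxC a).
  exact: (prime_filterI (stoneP s)).
have : filter_of s (a `|` ~` a)%O.
  by rewrite joinxC; exact: (prime_filterT (stoneP s)).
by case/(prime_filterU (stoneP s)).
Qed.

Lemma open_stone_open a : open (stone_open a).
Proof.
exists [set stone_open a]; last by rewrite bigcup_set1.
by move=> _ ->; apply: (@finI_from1 _ _ _ id); exists a.
Qed.

Lemma cvg_stone (F : set_system (stone B)) s :
  Filter F -> (forall a, filter_of s a -> F (stone_open a)) -> F --> s.
Proof.
move=> FF Fs A; rewrite nbhsE => -[_ [[D sD <-] [C DC Cs]] sA].
apply: (filterS sA); apply: (@filterS _ _ _ C); first by move=> t Ct; exists C.
have [E sE EC] := sD _ DC; move: Cs; rewrite -EC => Es.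
apply: filter_bigI => G GE; have := Es _ GE.
have /set_mem [a _ <-] := sE _ GE; exact: Fs.
Qed.

End StoneTopology.

(** If the relation fails at [(x, z)], the witnesses [i], [a], [c] of the failure
    define a basic neighborhood of [(x, z)] on which they still are witnesses;
    [~ filter_of z c] is an open condition on [z] since the points of the dual
    space are prime filters. *)
Lemma closed_dual_rel (tau : signature) (d : Order.disp_t)
    (B : residuationAlgebra tau d) (f : tau) :
  closed [set p : {ptws 'I_(arity f) -> stone B} * stone B |
    dual_rel p.1 p.2].
Proof.
rewrite -[X in closed X]setCK; apply: open_closedC; rewrite openE => -[x z].
rewrite /interior /= => /existsNP[i] /existsNP[a] /existsNP[c].
move=> /not_implyP[xa] /not_implyP[nzc] /contrapT xr.
have nbhs_stone b t : filter_of t b -> nbhs t (stone_open b).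
  by move=> tb; apply: open_nbhs_nbhs; split; first exact: open_stone_open.
exists ([set y : {ptws 'I_(arity f) -> stone B} |
          forall k, filter_of (drop_at i y k) (a k)] `&`
        [set y | filter_of (y i) (residual i a c)],
        stone_open (~` c)%O).
  split=> /=; last exact/nbhs_stone/filter_of_compl.
  apply: filterI.
    apply: (@nbhs_box _ _ (fun=> stone B) (lift i) (fun k => stone_open (a k))).
    by move=> k; exact/nbhs_stone/xa.
  apply: (@continuous_coordinate _ (fun=> stone B) i x
    (stone_open (residual i a c))).
  exact: nbhs_stone xr.
move=> [y w] /= [[ya yr] /filter_of_compl nwc] /(_ i a c ya nwc); exact.
Qed.

(** * Stone duality for a Boolean space *)

Section StoneOfClopens.
Context {X : topologicalType} (hX : boolean_space X).

Lemma clopen_nbhs (x : X) (W : set X) :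
  nbhs x W -> exists2 U : clopen_set X, clopen_val U x & clopen_val U `<=` W.
Proof.
have [_ _ [D sD [_ D_basis]]] := hX.
by move=> /D_basis[U [/sD cU Ux] sUW]; exists (clopen_of cU).
Qed.

Lemma clopen_separation (x y : X) :
  (forall U : clopen_set X, clopen_val U x -> clopen_val U y) -> x = y.
Proof.
have [_ hausX _] := hX => xy; apply: hausX => V W xV yW.
have [U Ux sUV] := clopen_nbhs xV.
by exists y; split; [exact/sUV/xy|exact: nbhs_singleton].
Qed.

Definition point_filter (x : X) : set (clopen_set X) :=
  [set U | clopen_val U x].

Lemma point_filter_prime (x : X) : prime_filter (point_filter x).
Proof.
by split=> // U V /clopen_subset sUV /sUV.
Qed.

Definition point_stone (x : X) : stone (clopen_set X) :=
  Stone (point_filter_prime x).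

(** A prime filter of clopen sets generates a proper filter on the compact space
    [X]. A cluster point of it lies in all members, as these are closed, and
    primality excludes any further clopen neighborhood of this point. *)
Lemma point_stone_surj (s : stone (clopen_set X)) : exists x, point_stone x = s.
Proof.
have [cX _ _] := hX.
pose F := filter_from (filter_of s) (@clopen_val X).
have FF : ProperFilter F.
  apply: filter_from_proper => [|U sU].
    apply: filter_from_filter.
      by exists \top; exact: prime_filterT (stoneP s).
    move=> U V sU sV; exists (U `&` V)%O => //.
    exact: prime_filterI (stoneP s) _ _ sU sV.
  apply/set0P/eqP => U0; apply: (prime_filter0 (stoneP s)).
  by rewrite -(_ : U = \bot) //; exact: val_inj.
have [x [_ clx]] := cX F FF filterT; exists x.
have sx U : filter_of s U -> clopen_val U x.
  move=> sU; have [_ clU] := clopen_set_clopen U.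
  by apply: clU => V xV; apply: clx => //; exists U.
apply: stone_eq; apply/seteqP; split=> U /=; last exact: sx.
by move=> Ux; apply: contrapT => /filter_of_compl /sx; apply.
Qed.

Lemma continuous_point_stone : continuous point_stone.
Proof.
move=> x; apply: cvg_stone => U Ux; apply: open_nbhs_nbhs; split=> //.
by have [] := clopen_set_clopen U.
Qed.

Definition stone_point (s : stone (clopen_set X)) : X :=
  sval (cid (point_stone_surj s)).

Lemma stone_pointK : cancel stone_point point_stone.
Proof. by move=> s; exact: svalP (cid (point_stone_surj s)). Qed.

Lemma point_stoneK : cancel point_stone stone_point.
Proof.
move=> x; apply/esym/clopen_separation => U Ux.
by rewrite -[_ (stone_point _)]/(filter_of (point_stone _) U) stone_pointK.
Qed.

Lemma continuous_stone_point : continuous stone_point.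
Proof.
move=> s W /clopen_nbhs[U Us sUW].
apply: (@filterS _ _ _ (stone_open U)).
  by move=> t tU; apply: sUW; rewrite -[t]stone_pointK in tU.
apply: open_nbhs_nbhs; split; first exact: open_stone_open.
by rewrite -[s]stone_pointK.
Qed.

(** The clopen boxes around [x] generate a filter that converges to [x] in each
    coordinate, hence in the product. *)
Lemma clopen_box (I : finType) (x : {ptws I -> X}) (W : set {ptws I -> X}) :
  nbhs x W ->
  exists2 a : I -> clopen_set X, (forall i, clopen_val (a i) (x i)) &
    [set y | forall i, clopen_val (a i) (y i)] `<=` W.
Proof.
pose box (a : I -> clopen_set X) : set {ptws I -> X} :=
  [set y | forall i, clopen_val (a i) (y i)].
pose F := filter_from [set a | box a x] box.
have FF : Filter F.
  apply: filter_from_filter; first by exists (fun=> \top).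
  move=> a b ax bx; exists (fun i => a i `&` b i)%O => [i|y ab].
    by split; [exact: ax|exact: bx].
  by split=> i; case: (ab i).
suff : F --> x by apply.
apply: cvg_coordinatewise => i V /clopen_nbhs[U Ux sUV].
(* The box constrained by [U] in the coordinate [i] only. *)
exists (fun j => if j == i then U else \top).
  by move=> j; case: eqP => // ->.
by move=> y /(_ i); rewrite eqxx => /sUV.
Qed.

End StoneOfClopens.

(** * Residuals of a continuous operation *)

Section Residual.
Context {X : topologicalType} (n : nat).
Variable op : {ptws 'I_n -> X} -> X.

Definition residual_set (i : 'I_n) (a : 'I_n.-1 -> set X) (c : set X) : set X :=
  [set x | forall y, y i = x -> (forall k, a k (drop_at i y k)) -> c (op y)].

(** The right-hand side does not mention [i]: this is the reason for the
    residuation law. *)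
Lemma residual_setP (i : 'I_n) (a : 'I_n -> set X) (c : set X) :
  a i `<=` residual_set i (drop_at i a) c <->
  (forall y, (forall k, a k (y k)) -> c (op y)).
Proof.
split=> [ares y ya|opac x ax y yx ya].
  by apply: (ares (y i)) => // k; exact: ya.
by apply: opac => k; case: (unliftP i k) => [j ->|->]; [exact: ya|rewrite yx].
Qed.

Hypothesis hX : boolean_space X.
Hypothesis op_continuous : continuous op.

(** The complement of the residual is the projection to the coordinate [i] of a
    clopen subset of the power of [X]. *)
Lemma clopen_residual_set i a c :
  (forall k, clopen (a k)) -> clopen c -> clopen (residual_set i a c).
Proof.
move=> cla clc; have [cX hausX _] := hX.
pose S : set {ptws 'I_n -> X} :=
  [set y | forall k, a k (drop_at i y k)] `&` op @^-1` (~` c).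
have -> : residual_set i a c = ~` ((fun y => y i) @` S).
  apply/seteqP; split=> [x rx [y [ya nc] yx]|x nx y yx ya].
    exact: nc (rx y yx ya).
  by apply: contrapT => nc; apply: nx; exists y.
have clS : clopen S.
  apply: clopenI; last by apply: preimage_clopen => //; exact: clopenC setT _.
  exact: (@clopen_coordinatewise _ _ (fun=> X) (lift i) a).
exact/(clopenC setT)/(@clopen_projection _ (fun=> X)).
Qed.

End Residual.

Section DualOfAlgebra.
Context {tau : signature} {X : topologicalType} (hX : boolean_space X).
Variable op : forall f : tau, {ptws 'I_(arity f) -> X} -> X.
Hypothesis op_continuous : forall f, continuous (@op f).

Definition clopen_residual (f : tau) (i : 'I_(arity f))
    (a : 'I_(arity f).-1 -> clopen_set X) (c : clopen_set X) : clopen_set X :=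
  clopen_of (clopen_residual_set hX (@op_continuous f) i
    (fun k => clopen_set_clopen (a k)) (clopen_set_clopen c)).

Lemma clopen_residualT (f : tau) (i : 'I_(arity f)) a :
  clopen_residual i a \top = \top.
Proof. by apply: val_inj; apply/seteqP; split. Qed.

Lemma clopen_residualI (f : tau) (i : 'I_(arity f)) a c c' :
  clopen_residual i a (c `&` c')%O =
  (clopen_residual i a c `&` clopen_residual i a c')%O.
Proof.
apply: val_inj; apply/seteqP; split=> [x xcc'|x [xc xc'] y yx ya].
  by split=> y yx ya; have [] := xcc' y yx ya.
by split; [exact: xc|exact: xc'].
Qed.

Lemma clopen_residuation (f : tau) (i j : 'I_(arity f))
    (a : 'I_(arity f) -> clopen_set X) (c : clopen_set X) :
  a i <= clopen_residual i (drop_at i a) c <->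
  a j <= clopen_residual j (drop_at j a) c.
Proof.
have resE k : a k <= clopen_residual k (drop_at k a) c <->
    (forall y, (forall l, clopen_val (a l) (y l)) -> clopen_val c (op y)).
  split=> [/clopen_subset|] H; last apply/clopen_subset.
    exact/(residual_setP _ k (@clopen_val X \o a)).
  exact/(residual_setP _ k (@clopen_val X \o a)).
by split=> /resE/resE.
Qed.

Definition clopen_algebra : residuationAlgebra tau set_display :=
  ResiduationAlgebra clopen_residualT clopen_residualI clopen_residuation.

(** From left to right, a clopen [c] separating [op x] from [z] and a clopen box
    around [x] that [op] maps into [c] give a contradiction; the relation may be
    read at any index, and positive arity provides one. From right to left, [x]
    itself is the tuple showing that the [i]-th component of [x] is outside the
    residual. *)
Lemma dual_rel_clopen_algebra (f : tau) (x : 'I_(arity f) -> X) (z : X) :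
  @dual_rel tau _ clopen_algebra f (point_stone \o x) (point_stone z) <->
  op x = z.
Proof.
split=> [xz|<- i a c xa nc /(_ x erefl xa)]; last exact: nc.
apply: clopen_separation => // c opc; apply: contrapT => nzc.
have [a ax sac] := clopen_box hX (op_continuous
  (open_nbhs_nbhs (conj (proj1 (clopen_set_clopen c)) opc))).
pose i := Ordinal (arity_gt0 f).
apply: (xz i (drop_at i a) c) => //= [k|]; first exact: ax.
have /(residual_setP _ i (@clopen_val X \o a)) := sac; apply; exact: ax.
Qed.

End DualOfAlgebra.

(** * Topological algebras as dual spaces *)

Theorem corollary3p7 (tau : signature) (X : topologicalType)
    (R : forall f : tau, ('I_(arity f) -> X) -> X -> Prop)
    (hX : boolean_space X) :
  (forall f : tau, exists op : {ptws 'I_(arity f) -> X} -> X,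
     continuous op /\ is_graph (R f) op)
  <->
  ((exists (d : Order.disp_t) (B : residuationAlgebra tau d),
      relational_iso R (fun f : tau => @dual_rel tau d B f)) /\
   (forall f : tau, exists op : ('I_(arity f) -> X) -> X,
      is_graph (R f) op)).
Proof.
split=> [topalg|[[d [B [h [g [_ _ h_cont _ R_dual]]]]] R_fun] f].
  split=> [|f]; last by have [op [_ opR]] := topalg f; exists op.
  pose op f := sval (cid (topalg f)).
  have op_cont f : continuous (op f) by have [] := svalP (cid (topalg f)).
  have opR f : is_graph (R f) (op f) by have [] := svalP (cid (topalg f)).
  exists set_display, (clopen_algebra hX op_cont).
  exists point_stone, (stone_point hX); split.
  - exact: point_stoneK.
  - exact: stone_pointK.
  - exact: continuous_point_stone.
  - exact: continuous_stone_point.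
  move=> f x z; apply: (iff_trans (opR f x z)); apply: iff_sym.
  exact: dual_rel_clopen_algebra.
have [op opR] := R_fun f; exists op; split=> //.
have [cX hausX _] := hX; apply: closed_graph_continuous => //.
(* The graph of [op] is the preimage of the closed dual relation under the map
   induced by [h], which is continuous. *)
pose hh (p : {ptws 'I_(arity f) -> X} * X) :
  {ptws 'I_(arity f) -> stone B} * stone B := (h \o p.1, h p.2).
rewrite (_ : [set p | _] = hh @^-1` [set q | dual_rel q.1 q.2]); last first.
  by apply/seteqP; split=> p /=; [move=> /opR/R_dual|move=> /R_dual/opR].
apply: (proj1 (continuous_closedP hh) _ _ (@closed_dual_rel _ _ _ _)).
move=> [x z] W [[U V] /= [xU zV] sUVW].
exists ((fun y : {ptws 'I_(arity f) -> X} => h \o y) @^-1` U, h @^-1` V).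
  by split; [exact: (continuous_postcomp h_cont xU)|exact: h_cont].
by move=> [y w] [yU wV]; apply: sUVW.
Qed.
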